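(* Let $(X,\mathcal{G}_X)$ be a convex geometry and let $\{(Y_x,\mathcal{G}_x) : x\in X\}$ be a family of convex geometries such that the sets $Y_x$ are pairwise disjoint and disjoint from $X$. Then the resolution $(Z,\mathcal{G}_Z)$ of $(X,\mathcal{G}_X)$ into $\{(Y_x,\mathcal{G}_x) : x\in X\}$ is a convex geometry.
   Context: A convex geometry on a finite nonempty set $X$ is a family $\mathcal{G}\subseteq 2^X$ such that: (G1) $\varnothing\in\mathcal{G}$; (G2) if $F,G\in\mathcal{G}$ then $F\cap G\in\mathcal{G}$; (G3) for every $G\in\mathcal{G}\setminus\{X\}$ there is $x\in X\setminus G$ with $G\cup\{x\}\in\mathcal{G}$. The pair $(X,\mathcal{G})$ is also called a convex geometry. For $A\subseteq X$, the convex hull is $\operatorname{conv}_{\mathcal{G}}(A)=\bigcap\{G\in\mathcal{G}: A\subseteq G\}$, and the set of extreme elements of $A$ is $\operatorname{ex}_{\mathcal{G}}(A)=\{a\in A: a\notin\operatorname{conv}_{\mathcal{G}}(A\setminus\{a\})\}$. Resolution: let $(X,\mathcal{G}_X)$ be a convex geometry (the base) and $\{(Y_x,\mathcal{G}_x):x\in X\}$ a family of convex geometries (the fibers), where the sets $Y_x$ are pairwise disjoint and disjoint from $X$. Let $Z=\bigcup_{x\in X}Y_x$ and let $\pi\colon Z\to X$ be the projection given by $\pi(z)=x$ for $z\in Y_x$. The resolution of $(X,\mathcal{G}_X)$ into $\{(Y_x,\mathcal{G}_x):x\in X\}$ is the pair $(Z,\mathcal{G}_Z)$, where $\mathcal{G}_Z$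 consists of all $A\subseteq Z$ such that: (R1) $\pi(A)\in\mathcal{G}_X$; (R2) $A\cap Y_x\in\mathcal{G}_x$ for all $x\in\pi(A)$; (R3) $Y_x\subseteq A$ for all $x\in\pi(A)\setminus\operatorname{ex}_{\mathcal{G}_X}(\pi(A))$. *)

(* Defs.v *)
From mathcomp Require Import all_boot.

Set Implicit Arguments.
Unset Strict Implicit.
Unset Printing Implicit Defensive.

(* All ground sets are subsets of an ambient finType T, so that they can be
   compared and required to be disjoint. *)

Record convex_geometry (T : finType) (X : {set T}) (G : {set {set T}}) : Prop :=
  ConvexGeometry {
    cg_nonempty : X != set0;
    cg_family : G \subset powerset X;
    cg_set0 : set0 \in G;
    cg_setI : forall F H, F \in G -> H \in G -> F :&: H \in G;
    cg_extend : forall H, H \in G :\ X -> exists2 x, x \in X :\: H & x |: H \in G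
  }.

(* An empty intersection is [set: T]; this does not occur for A \subset X in a
   convex geometry on X, since cg_set0 and cg_extend force X \in G. *)
Definition conv (T : finType) (G : {set {set T}}) (A : {set T}) : {set T} :=
  \bigcap_(H in G | A \subset H) H.

Definition ex (T : finType) (G : {set {set T}}) (A : {set T}) : {set T} :=
  [set a in A | a \notin conv G (A :\ a)].

Section Resolution.

(* Only the values of Y and GY at points of X matter. *)
Variables (T : finType) (X : {set T}) (GX : {set {set T}}).
Variables (Y : T -> {set T}) (GY : T -> {set {set T}}).

Definition resolution_ground : {set T} := \bigcup_(x in X) Y x.

(* The x in X with z \in Y x, unique when the fibers are pairwise disjoint;
   the default value z is only taken outside resolution_ground. *)
Definition resolution_proj (z : T) : T := odflt z [pick x in X | z \in Y x].

Definition resolution : {set {set T}} :=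
  [set A in powerset resolution_ground |
    let piA := resolution_proj @: A in
    [&& piA \in GX,
        [forall x in piA, A :&: Y x \in GY x] &
        [forall x in piA :\: ex GX piA, Y x \subset A]]].

End Resolution.

(* Main.v *)
Require Import Defs.
From mathcomp Require Import all_boot.

(** The argument rests on one observation about a family [G] stable under
    intersection: a point [x] of a member [P] is extreme exactly when [P :\ x]
    is again a member ([ex_closedE]).  Hence extreme points of a member stay
    extreme in every smaller member that contains them ([ex_closedS]), and any
    set of extreme points can be removed at once ([closedD_ex]).

    Intersections ([resolutionI]).  Let [A] and [B] be in the resolution.  The
    projection of [A :&: B] may be smaller than the intersection [P] of the two
    projections, but a point [x] that gets lost has a fiber met by both sets in
    disjoint parts, so that neither contains the whole fiber.  By (R3), [x] is
    extreme in both projections, hence in [P]; so the projection of [A :&: B] is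
    [P] with some extreme points removed, and it is in the base.  (R3) for
    [A :&: B] is inherited from [A] and [B] because extreme points stay extreme
    in smaller members.

    Extension.  If some fiber over the projection of [A] is not contained in
    [A], its base point is extreme by (R3), and [A] grows inside that fiber.
    Otherwise [A] is a union of fibers; the projection grows by a point [x] of
    the base, which is extreme in the enlarged set, and [A] grows by a point of
    the fiber over [x] that extends the empty set.  Both cases are instances of
    [resolutionU1]. *)

Set Implicit Arguments.
Unset Strict Implicit.
Unset Printing Implicit Defensive.

Section ExtremePoints.

Context (T : finType) (G : {set {set T}}).
Implicit Types (A P Q : {set T}) (x : T).

Definition stableI := forall P Q, P \in G -> Q \in G -> P :&: Q \in G.

Lemma convP A x :
  reflect (forall P, P \in G -> A \subset P -> x \in P) (x \in conv G A).
Proof.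
apply: (iffP bigcapP) => [cA P GP AP|cA P /andP[]]; last exact: cA.
by apply: cA; rewrite GP.
Qed.

(** A member that contains [P :\ x] but not [x] cuts [P] down to [P :\ x]. *)
Lemma ex_closedE P x :
  stableI -> P \in G -> (x \in ex G P) = (x \in P) && (P :\ x \in G).
Proof.
move=> GI GP; rewrite inE; case: (boolP (x \in P)) => //= Px.
apply/idP/idP => [nc|GPx]; last first.
  by apply/negP => /convP/(_ _ GPx (subxx _)); rewrite !inE eqxx.
have [Q GQ /andP[PQ nQx]] : exists2 Q, Q \in G & (P :\ x \subset Q) && (x \notin Q).
  apply/exists_inP; apply: contraR nc; rewrite negb_exists_in => /forall_inP nQ.
  by apply/convP => Q GQ PQ; move: (nQ Q GQ); rewrite PQ negbK.
suff -> : P :\ x = P :&: Q by exact: GI.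
apply/setP => z; rewrite !inE andbC; case: (boolP (z \in P)) => //= Pz.
case: eqVneq => [->|zx] /=; first by rewrite (negPf nQx).
by rewrite (subsetP PQ) // !inE zx.
Qed.

(** If [P :\ x] is a member, so is its trace [Q :\ x] on [Q]. *)
Lemma ex_closedS P Q x :
    stableI -> P \in G -> Q \in G -> Q \subset P -> x \in Q ->
  x \in ex G P -> x \in ex G Q.
Proof.
move=> GI GP GQ QP Qx; rewrite !ex_closedE // Qx => /andP[_ GPx] /=.
suff -> : Q :\ x = Q :&: (P :\ x) by exact: GI.
by rewrite setIDA (setIidPl QP).
Qed.

(** By [ex_closedE], [Q] is the intersection of [P] with the members [P :\ x],
    for [x] in [P :\: Q]. *)
Lemma closedD_ex P Q :
  stableI -> P \in G -> Q \subset P -> P :\: Q \subset ex G P -> Q \in G.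
Proof.
move=> GI GP QP PQex.
suff -> : Q = P :&: \bigcap_(x in P :\: Q) (P :\ x).
  elim/big_rec: _ => [|x A PQx GA]; first by rewrite setIT.
  rewrite setICA; apply: (GI) => //.
  by have := subsetP PQex x PQx; rewrite (ex_closedE _ GI GP) => /andP[].
apply/setP => z; rewrite inE; apply/idP/andP => [Qz|[Pz /bigcapP cz]].
  have Pz := subsetP QP z Qz; split=> //; apply/bigcapP => x.
  by rewrite !inE Pz andbT => /andP[nQx _]; apply: contraNneq nQx => <-.
by apply/negPn/negP => nQz; move: (cz z); rewrite !inE nQz Pz eqxx => /(_ isT).
Qed.

End ExtremePoints.

Section Resolution.

Context (T : finType) (X : {set T}) (GX : {set {set T}}).
Context (Y : T -> {set T}) (GY : T -> {set {set T}}).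
Implicit Types (A B : {set T}) (x y z : T).

Local Notation Z := (resolution_ground X Y).
Local Notation proj := (resolution_proj X Y).
Local Notation GZ := (resolution X GX Y GY).

Definition disjoint_fibers :=
  forall x x', x \in X -> x' \in X -> x != x' -> [disjoint Y x & Y x'].

Lemma resolutionP A :
  reflect [/\ A \subset Z, proj @: A \in GX,
              forall x, x \in proj @: A -> A :&: Y x \in GY x
            & forall x, x \in proj @: A -> x \notin ex GX (proj @: A) ->
                Y x \subset A]
          (A \in GZ).
Proof.
rewrite inE /= powersetE; apply: (iffP andP).
  move=> [AZ /and3P[GA /forall_inP R2 /forall_inP R3]]; split=> // x Ax nex.
  by apply: R3; rewrite inE nex.
move=> [AZ GA R2 R3]; split=> //; apply/and3P; split=> //; apply/forall_inP => // x.
by rewrite inE => /andP[nex Ax]; apply: R3.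
Qed.

Lemma sub_fiber_ground x : x \in X -> Y x \subset Z.
Proof. by move=> Xx; apply: bigcup_sup. Qed.

Lemma fiber_eq x x' z :
  disjoint_fibers -> x \in X -> x' \in X -> z \in Y x -> z \in Y x' -> x = x'.
Proof.
move=> dY Xx Xx' Yz Yz'; apply/eqP/negPn/negP => /(dY _ _ Xx Xx')/pred0P/(_ z).
by rewrite /= Yz Yz'.
Qed.

Lemma projE x z : disjoint_fibers -> x \in X -> z \in Y x -> proj z = x.
Proof.
move=> dY Xx Yz; rewrite /resolution_proj; case: pickP => [x' /andP[Xx' Yz']|/(_ x)] /=.
  exact: fiber_eq Yz' Yz.
by rewrite Xx Yz.
Qed.

Lemma projectionP A x :
    disjoint_fibers -> A \subset Z ->
  reflect (x \in X /\ exists2 z, z \in A & z \in Y x) (x \in proj @: A).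
Proof.
move=> dY AZ; apply: (iffP imsetP) => [[z Az ->]|[Xx [z Az Yz]]].
  have /bigcupP[x' Xx' Yz] := subsetP AZ z Az.
  by rewrite (projE dY Xx' Yz); split=> //; exists z.
by exists z => //; rewrite (projE dY Xx Yz).
Qed.

(** For (R1), the base points over which [A] and [B] are both nonempty but
    disjoint are extreme in the intersection of the projections, which
    therefore stays in the base once they are removed. *)
Lemma resolutionI A B :
  disjoint_fibers -> stableI GX -> (forall x, x \in X -> stableI (GY x)) ->
  A \in GZ -> B \in GZ -> A :&: B \in GZ.
Proof.
move=> dY IX IY /resolutionP[AZ GA A2 A3] /resolutionP[BZ GB B2 B3].
have CZ : A :&: B \subset Z := subset_trans (subsetIl A B) AZ.
have CA : proj @: (A :&: B) \subset proj @: A := imsetS _ (subsetIl A B).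
have CB : proj @: (A :&: B) \subset proj @: B := imsetS _ (subsetIr A B).
have GP : proj @: A :&: proj @: B \in GX := IX _ _ GA GB.
have GC : proj @: (A :&: B) \in GX.
  apply: (closedD_ex IX GP); first by rewrite subsetI CA.
  apply/subsetP => x; rewrite in_setD in_setI => /andP[nCx /andP[Ax Bx]].
  have [Xx [a Aa Ya]] := projectionP x dY AZ Ax.
  have [_ [b Bb Yb]] := projectionP x dY BZ Bx.
  apply: (ex_closedS IX GA GP (subsetIl _ _)); first by rewrite inE Ax.
  (* Were [x] not extreme, (R3) would put [b] in [A], so [A :&: B] would meet
     the fiber over [x]. *)
  apply: contraR nCx => /(A3 _ Ax) YA; apply/projectionP => //; split=> //.
  by exists b; rewrite // inE (subsetP YA).
apply/resolutionP; split=> // x Cx.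
  have [Xx _] := projectionP x dY CZ Cx.
  rewrite setIIl; apply: IY => //; [apply: A2|apply: B2].
    exact: (subsetP CA).
  exact: (subsetP CB).
have Ax := subsetP CA x Cx; have Bx := subsetP CB x Cx.
move=> nex; rewrite subsetI A3 ?B3 //; apply: contra nex.
  exact: ex_closedS.
exact: ex_closedS.
Qed.

(** The point [x] may or may not lie in the projection of [A]: stating
    extremality in [x |: proj @: A] treats growth inside a fiber already met by
    [A] and growth over a new base point together.  Fibers over points other
    than [x] meet [A] and [y |: A] alike, and extremality of [x] exempts its own
    fiber from (R3). *)
Lemma resolutionU1 A x y :
  disjoint_fibers -> x \in X -> y \in Y x -> A \in GZ ->
  x |: proj @: A \in GX -> x \in ex GX (x |: proj @: A) ->
  (forall x', x' \in proj @: A -> x' \notin ex GX (x |: proj @: A) ->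
     Y x' \subset A) ->
  y |: A :&: Y x \in GY x -> y |: A \in GZ.
Proof.
move=> dY Xx Yy /resolutionP[AZ GA A2 A3] GxA xex full GyA.
have BZ : y |: A \subset Z.
  by rewrite subUset sub1set AZ andbT; apply: subsetP Yy; apply: sub_fiber_ground.
have projB : proj @: (y |: A) = x |: proj @: A.
  by rewrite imsetU1 (projE dY Xx Yy).
apply/resolutionP; rewrite projB; split=> // x'.
  have Bx : (y |: A) :&: Y x = y |: A :&: Y x.
    by rewrite setIUl; congr (_ :|: _); apply/setIidPl; rewrite sub1set.
  have [-> _|x'x] := eqVneq x' x; first by rewrite Bx.
  rewrite in_setU1 (negPf x'x) /= => Ax'.
  have [Xx' _] := projectionP x' dY AZ Ax'.
  suff -> : (y |: A) :&: Y x' = A :&: Y x' by exact: A2.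
  rewrite setIUl; apply/setUidPr/subsetP => z; rewrite in_setI in_set1.
  by move=> /andP[/eqP -> Yy']; rewrite (fiber_eq dY Xx Xx' Yy Yy') eqxx in x'x.
rewrite in_setU1 => /predU1P[->|Ax'] nex; first by rewrite xex in nex.
exact: subset_trans (full x' Ax' nex) (subsetUr _ _).
Qed.

End Resolution.

Theorem theorem3p3 (T : finType) (X : {set T}) (GX : {set {set T}})
    (Y : T -> {set T}) (GY : T -> {set {set T}})
    (baseP : convex_geometry X GX)
    (fiberP : forall x, x \in X -> convex_geometry (Y x) (GY x))
    (disjY : forall x x', x \in X -> x' \in X -> x != x' ->
               [disjoint Y x & Y x'])
    (disjX : forall x, x \in X -> [disjoint Y x & X]) :
  convex_geometry (resolution_ground X Y) (resolution X GX Y GY).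
Proof.
have IX : stableI GX by exact: cg_setI baseP.
split.
- have /set0Pn[x Xx] := cg_nonempty baseP.
  have /set0Pn[y Yy] := cg_nonempty (fiberP x Xx).
  by apply/set0Pn; exists y; apply/bigcupP; exists x.
- by apply/subsetP => A; rewrite inE => /andP[].
- apply/resolutionP; rewrite imset0 sub0set (cg_set0 baseP).
  by split=> // x; rewrite inE.
- move=> A B; apply: resolutionI => // x Xx; exact: cg_setI (fiberP x Xx).
move=> A; rewrite in_setD1 => /andP[AneZ GZA].
have /resolutionP[AZ GA A2 A3] := GZA.
set P := resolution_proj X Y @: A in GA A2 A3.
have [/existsP[x /andP[Px nYA]]|] :=
    boolP [exists x, (x \in P) && ~~ (Y x \subset A)].
  have [Xx _] := projectionP x disjY AZ Px.
  have xP : x |: P = P by apply/setUidPr; rewrite sub1set.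
  have [|y /setDP[Yy nAy] GyA] := cg_extend (fiberP x Xx) (H := A :&: Y x).
    rewrite in_setD1 A2 // andbT; apply: contra nYA => /eqP <-; exact: subsetIl.
  exists y; last first.
    apply: (resolutionU1 disjY Xx Yy GZA) => //; rewrite xP //.
    by apply: contraR nYA; apply: A3.
  rewrite in_setD (subsetP (sub_fiber_ground Y Xx)) // andbT.
  by apply: contra nAy => Ay; rewrite inE Ay.
rewrite negb_exists => /forallP nfull.
have full x : x \in P -> Y x \subset A.
  by move=> Px; move: (nfull x); rewrite Px negbK.
have [|x /setDP[Xx nPx] GxP] := cg_extend baseP (H := P).
  rewrite in_setD1 GA andbT; apply: contra AneZ => /eqP PX.
  by rewrite eqEsubset AZ; apply/bigcupsP => x Xx; apply: full; rewrite PX.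
have AYx : A :&: Y x = set0.
  apply/setP => z; rewrite in_set0 in_setI; apply: contraNF nPx => /andP[Az Yz].
  by apply/projectionP => //; split=> //; exists z.
have [|y /setDP[Yy _] Gy] := cg_extend (fiberP x Xx) (H := set0).
  by rewrite in_setD1 eq_sym (cg_nonempty (fiberP x Xx)) (cg_set0 (fiberP x Xx)).
exists y.
  rewrite in_setD (subsetP (sub_fiber_ground Y Xx)) // andbT.
  by move/setP/(_ y): AYx; rewrite in_setI Yy andbT in_set0 => ->.
apply: (resolutionU1 disjY Xx Yy GZA) => //; last by rewrite AYx.
  by rewrite ex_closedE // setU11 setU1K.
by move=> x' Px' _; apply: full.
Qed.
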